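(* Let $(\mathcal{A}_n)_{n\in\mathbb N}$ be a sequence of Dedekind-finite (unital) Banach algebras. Then the asymptotic sequence algebra $\mathrm{Asy}(\mathcal{A}_n)$ is Dedekind-finite.
   Context: Banach algebras are complex and have a contractive product $\|ab\|\le\|a\|\|b\|$; a unital Banach algebra has unit $1$ with $\|1\|=1$. For a sequence $(\mathcal A_n)$ of Banach algebras, $\ell^\infty(\mathcal A_n)$ is the Banach algebra of all bounded sequences $(a_n)$ with $a_n\in\mathcal A_n$, with pointwise operations and the supremum norm; $c_0(\mathcal A_n)$ is the closed two-sided ideal of sequences with $\lim_{n\to\infty}\|a_n\|=0$; and $\mathrm{Asy}(\mathcal A_n)=\ell^\infty(\mathcal A_n)/c_0(\mathcal A_n)$ with the quotient norm. Two idempotents $p,q$ in an algebra $\mathcal A$ are equivalent, $p\sim q$, if there are $a,b\in\mathcal A$ with $p=ab$ and $q=ba$. A unital algebra $\mathcal A$ is Dedekind-finite if every idempotent $p\in\mathcal A$ with $p\sim 1$ satisfies $p=1$. *)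

(* Defs.v *)
From HB Require Import structures.
From mathcomp Require Import all_boot all_order all_algebra.
From mathcomp Require Import complex.
From mathcomp Require Import all_classical all_reals all_analysis.
From mathcomp Require Import lra.

Set Implicit Arguments.
Unset Strict Implicit.
Unset Printing Implicit Defensive.

Import Order.TTheory GRing.Theory Num.Theory.
Import numFieldNormedType.Exports.

Local Open Scope classical_set_scope.
Local Open Scope ring_scope.
Local Open Scope complex_scope.
Local Open Scope quotient_scope.

Definition idempotent_elt (A : pzRingType) (p : A) : Prop := p * p = p.

Definition idem_equiv (A : pzRingType) (p q : A) : Prop :=
  exists a b : A, p = a * b /\ q = b * a.

Definition dedekind_finite (A : pzRingType) : Prop :=
  forall p : A, idempotent_elt p -> idem_equiv p 1 -> p = 1.

(* Complex unital Banach algebras.  Hierarchy-Builder cannot join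
   completeNormedModType with algType (a join below numDomainType is missing),
   hence a record; the ring and algebra structures are declared below on
   [banach_sort]. *)
Record banachAlgType (R : realType) := BanachAlg {
  banach_module : completeNormedModType R[i] ;
  banach_one : banach_module ;
  banach_mul : banach_module -> banach_module -> banach_module ;
  banach_mulA : associative banach_mul ;
  banach_mul1x : left_id banach_one banach_mul ;
  banach_mulx1 : right_id banach_one banach_mul ;
  banach_mulDl : left_distributive banach_mul +%R ;
  banach_mulDr : right_distributive banach_mul +%R ;
  banach_scaleAl : forall k x y,
    k *: banach_mul x y = banach_mul (k *: x) y ;
  banach_scaleAr : forall k x y,
    k *: banach_mul x y = banach_mul x (k *: y) ;
  banach_normM_subproof : forall x y, `|banach_mul x y| <= `|x| * `|y| ;
  banach_norm1_subproof : `|banach_one| = 1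
}.

Definition banach_sort (R : realType) (A : banachAlgType R) : Type :=
  banach_module A.
Coercion banach_sort : banachAlgType >-> Sortclass.

Section BanachAlgebra.
Variables (R : realType) (A : banachAlgType R).

HB.instance Definition _ := CompleteNormedModule.on (banach_sort A).

Let banach_one_neq0 : banach_one A != 0 :> banach_sort A.
Proof. by rewrite -normr_eq0 banach_norm1_subproof oner_eq0. Qed.

HB.instance Definition _ := GRing.Zmodule_isNzRing.Build (banach_sort A)
  (@banach_mulA R A) (@banach_mul1x R A) (@banach_mulx1 R A)
  (@banach_mulDl R A) (@banach_mulDr R A) banach_one_neq0.

HB.instance Definition _ := GRing.Lmodule_isLalgebra.Build R[i] (banach_sort A)
  (@banach_scaleAl R A).

HB.instance Definition _ := GRing.Lalgebra_isAlgebra.Build R[i] (banach_sort A)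
  (@banach_scaleAr R A).

Lemma banach_normM (x y : A) : `|x * y| <= `|x| * `|y|.
Proof. exact: banach_normM_subproof. Qed.

Lemma banach_norm1 : `|1 : A| = 1.
Proof. exact: banach_norm1_subproof. Qed.

End BanachAlgebra.

(* The norm of a normedModType over R[i] takes its (real, nonnegative) values
   in R[i]; [rnorm] is the same norm with values in R, see [rnormE]. *)
Section RealNorm.
Variable R : realType.

Definition rnorm (V : normedModType R[i]) (x : V) : R := complex.Re `|x|.

Lemma ReK (z : R[i]) : 0 <= z -> (complex.Re z)%:C = z.
Proof. by move=> z0; rewrite RRe_real // realE z0. Qed.

Variable V : normedModType R[i].
Implicit Types (x y : V) (k : R[i]).

Lemma rnormE x : `|x| = (rnorm x)%:C.
Proof. by rewrite ReK. Qed.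

Lemma rnorm_ge0 x : 0 <= rnorm x.
Proof. by rewrite -(@lecR R) -rnormE rmorph0 normr_ge0. Qed.

Lemma rnorm0 : rnorm (0 : V) = 0.
Proof. by rewrite /rnorm normr0. Qed.

Lemma rnorm0_eq0 x : rnorm x = 0 -> x = 0.
Proof. by move=> x0; apply/normr0_eq0; rewrite rnormE x0. Qed.

Lemma rnormD x y : rnorm (x + y) <= rnorm x + rnorm y.
Proof. by rewrite -(@lecR R) rmorphD /= -!rnormE ler_normD. Qed.

Lemma rnormN x : rnorm (- x) = rnorm x.
Proof. by rewrite /rnorm normrN. Qed.

Lemma rnormB x y : rnorm (x - y) = rnorm (y - x).
Proof. by rewrite /rnorm distrC. Qed.

Lemma rnormZ k x : rnorm (k *: x) = complex.Re `|k| * rnorm x.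
Proof.
by apply: (@complexI R); rewrite rmorphM /= -!rnormE normrZ.
Qed.

End RealNorm.

Section RealNormBanach.
Variables (R : realType) (A : banachAlgType R).

Lemma rnormM (x y : A) : rnorm (x * y) <= rnorm x * rnorm y.
Proof. by rewrite -(@lecR R) rmorphM /= -!rnormE banach_normM. Qed.

Lemma rnorm1 : rnorm (1 : A) = 1.
Proof. by rewrite /rnorm banach_norm1. Qed.

End RealNormBanach.

(* Completeness through sequences whose consecutive terms are 2^-k-close *)
Section FastCauchy.
Variable R : realType.
Implicit Types V : normedModType R[i].

Definition fast V (u : nat -> V) : Prop :=
  forall k, rnorm (u k.+1 - u k) < 2^-1 ^+ k.

Definition fast_complete V : Prop := forall u : nat -> V, fast u ->
  exists l : V, forall k, rnorm (l - u k) <= 2 * 2^-1 ^+ k.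

Lemma exp2V_lt (e : R) : 0 < e -> exists k, 2^-1 ^+ k < e.
Proof.
move=> e0; have [n _ /(_ n (leqnn n))] :=
  @near_infty_natSinv_expn_lt R (PosNum e0).
by rewrite div1r -exprVn => ?; exists n.
Qed.

Lemma Re_gt0 (e : R[i]) : 0 < e -> 0 < complex.Re e /\ e = (complex.Re e)%:C.
Proof.
move=> e0; have eE := ReK (ltW e0); split; last by rewrite eE.
by rewrite -(@ltcR R) eE rmorph0.
Qed.

Lemma fast_dist V (u : nat -> V) (k m : nat) : fast u ->
  rnorm (u (k + m)%N - u k) <= 2 * (2^-1 ^+ k - 2^-1 ^+ (k + m)).
Proof.
move=> fu; elim: m => [|m IH]; first by rewrite addn0 !subrr rnorm0 mulr0.
rewrite addnS -[_ - u k](subrKA (u (k + m)%N)).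
apply: le_trans (rnormD _ _) _.
have := fu (k + m)%N; rewrite exprSr; move: IH.
move: (2^-1 ^+ (k + m)) => a; move: (2^-1 ^+ k) => b; lra.
Qed.

Lemma complete_fast (V : completeNormedModType R[i]) : fast_complete V.
Proof.
move=> u fu.
have dist k n : (k <= n)%N -> rnorm (u n - u k) <= 2 * 2^-1 ^+ k.
  move=> kn; apply: (le_trans (y := 2 * (2^-1 ^+ k - 2^-1 ^+ n))).
    by rewrite -(subnKC kn) fast_dist.
  by rewrite ler_pM2l // gerBl exprn_ge0.
have /cauchy_cvgP/cvg_ex[l ul] : cauchy (u @ \oo).
  apply: cauchy_exP => e /Re_gt0[]; move: (complex.Re e) => r r0 ->.
  have [|k k2] := @exp2V_lt (r / 2); first by rewrite divr_gt0.
  exists (u k), k => // n /= kn; rewrite -ball_normE /= rnormE ltcR rnormB.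
  by rewrite (le_lt_trans (dist _ _ kn)) // mulrC -ltr_pdivlMr.
exists l => k; apply/ler_addgt0Pr => e e0.
move/cvgrPdist_lt: ul => /(_ e%:C).
rewrite ltcR => /(_ e0)[N _ /(_ (maxn N k))].
rewrite /= leq_maxl rnormE ltcR => /(_ isT) lt_e.
rewrite -[l - _](subrKA (u (maxn N k))) (le_trans (rnormD _ _)) //.
by rewrite addrC lerD ?dist ?leq_maxr ?ltW.
Qed.

Lemma fast_cauchy_cvg V : fast_complete V ->
  forall F : set_system V, ProperFilter F -> cauchy F -> cvg F.
Proof.
move=> fV F PF /cauchyP cF.
have /choice[u Fu] (k : nat) : exists x : V, F (ball x (2^-1 ^+ k.+2)%:C).
  by apply: cF; rewrite ltcR exprn_gt0 ?invr_gt0.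
have uu (k : nat) : rnorm (u k.+1 - u k) < 2^-1 ^+ k.
  have [x []] := filter_ex (filterI (Fu k) (Fu k.+1)).
  rewrite -!ball_normE /= !rnormE !ltcR => h1 h2.
  rewrite -(subrKA x) (le_lt_trans (rnormD _ _)) //.
  have : 0 <= 2^-1 ^+ k :> R by rewrite exprn_ge0 // invr_ge0.
  move: h1 h2; rewrite (rnormB (u k)) !exprSr.
  move: (2^-1 ^+ k) => a; lra.
have [l ul] := fV u uu.
apply/cvg_ex; exists l => /=; apply/fcvgrPdist_lt => e /Re_gt0[].
move: (complex.Re e) => r r0 ->.
have [|k k2] := @exp2V_lt (r / 3); first by rewrite divr_gt0.
apply: filterS (Fu k) => x; rewrite -ball_normE /= !rnormE !ltcR => h.
rewrite -(subrKA (u k)) (le_lt_trans (rnormD _ _)) //.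
have : 0 <= 2^-1 ^+ k :> R by rewrite exprn_ge0 // invr_ge0.
move: h (ul k) k2; rewrite !exprSr.
move: (2^-1 ^+ k) => a; lra.
Qed.

End FastCauchy.

Section BoundedSequences.
Variables (R : realType) (A : nat -> banachAlgType R).

Record linf := Linf {
  linf_seq :> forall n, A n ;
  linf_bounded : exists M : R, forall n, rnorm (linf_seq n) <= M
}.

Lemma linfP (a b : linf) : (forall n, a n = b n) -> a = b.
Proof.
case: a b => [a Ha] [b Hb] /= ab.
have {}ab : a = b by apply: functional_extensionality_dep.
by case: b / ab Hb => Hb; congr Linf; exact: Prop_irrelevance.
Qed.

HB.instance Definition _ := gen_eqMixin linf.
HB.instance Definition _ := gen_choiceMixin linf.

Implicit Types (a b : linf) (k : R[i]).

Let bounded0 : exists M : R, forall n, rnorm (0 : A n) <= M.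
Proof. by exists 0 => n; rewrite rnorm0. Qed.

Let bounded1 : exists M : R, forall n, rnorm (1 : A n) <= M.
Proof. by exists 1 => n; rewrite rnorm1. Qed.

Let boundedN a : exists M : R, forall n, rnorm (- a n) <= M.
Proof. by have [M aM] := linf_bounded a; exists M => n; rewrite rnormN. Qed.

Let boundedD a b : exists M : R, forall n, rnorm (a n + b n) <= M.
Proof.
have [[M aM] [N bN]] := (linf_bounded a, linf_bounded b).
by exists (M + N) => n; rewrite (le_trans (rnormD _ _)) ?lerD.
Qed.

Let boundedM a b : exists M : R, forall n, rnorm (a n * b n) <= M.
Proof.
have [[M aM] [N bN]] := (linf_bounded a, linf_bounded b).
by exists (M * N) => n; rewrite (le_trans (rnormM _ _)) ?ler_pM ?rnorm_ge0.
Qed.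

Let boundedZ k a : exists M : R, forall n, rnorm (k *: a n) <= M.
Proof.
have [M aM] := linf_bounded a; exists (complex.Re `|k| * M) => n.
by rewrite rnormZ ler_wpM2l // (rnorm_ge0 (k : R[i]^o)).
Qed.

Definition linf_zero : linf := Linf bounded0.
Definition linf_one : linf := Linf bounded1.
Definition linf_opp a : linf := Linf (boundedN a).
Definition linf_add a b : linf := Linf (boundedD a b).
Definition linf_mul a b : linf := Linf (boundedM a b).
Definition linf_scale k a : linf := Linf (boundedZ k a).

Let linf_addA : associative linf_add.
Proof. by move=> a b c; apply: linfP => n /=; rewrite addrA. Qed.
Let linf_addC : commutative linf_add.
Proof. by move=> a b; apply: linfP => n /=; rewrite addrC. Qed.
Let linf_add0 : left_id linf_zero linf_add.
Proof. by move=> a; apply: linfP => n /=; rewrite add0r. Qed.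
Let linf_addN : left_inverse linf_zero linf_opp linf_add.
Proof. by move=> a; apply: linfP => n /=; rewrite addNr. Qed.

HB.instance Definition _ :=
  GRing.isZmodule.Build linf linf_addA linf_addC linf_add0 linf_addN.

Let linf_scaleA k l a : linf_scale k (linf_scale l a) = linf_scale (k * l) a.
Proof. by apply: linfP => n /=; rewrite scalerA. Qed.
Let linf_scale1 : left_id 1 linf_scale.
Proof. by move=> a; apply: linfP => n /=; rewrite scale1r. Qed.
Let linf_scaleDr : right_distributive linf_scale +%R.
Proof. by move=> k a b; apply: linfP => n /=; rewrite scalerDr. Qed.
Let linf_scaleDl a : {morph linf_scale^~ a : k l / k + l}.
Proof. by move=> k l; apply: linfP => n /=; rewrite scalerDl. Qed.

HB.instance Definition _ := GRing.Zmodule_isLmodule.Build R[i] linf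
  linf_scaleA linf_scale1 linf_scaleDr linf_scaleDl.

Lemma linfDE a b n : (a + b) n = a n + b n. Proof. by []. Qed.
Lemma linfNE a n : (- a) n = - a n. Proof. by []. Qed.
Lemma linfBE a b n : (a - b) n = a n - b n. Proof. by []. Qed.
Lemma linfME a b n : linf_mul a b n = a n * b n. Proof. by []. Qed.
Lemma linfZE k a n : (k *: a) n = k *: a n. Proof. by []. Qed.

Definition linf_norm a : R := sup (range (fun n => rnorm (a n))).

Lemma linf_norm_ub a n : rnorm (a n) <= linf_norm a.
Proof.
apply: ub_le_sup; last by exists n.
by have [M aM] := linf_bounded a; exists M => _ [m _ <-].
Qed.

Lemma linf_norm_le a (M : R) :
  (forall n, rnorm (a n) <= M) -> linf_norm a <= M.
Proof.
move=> aM; apply: ge_sup; first by exists (rnorm (a 0)); exists 0%N.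
by move=> _ [n _ <-].
Qed.

Lemma linf_norm_ge0 a : 0 <= linf_norm a.
Proof. exact: le_trans (rnorm_ge0 _) (linf_norm_ub a 0). Qed.

Lemma linf_normM a b : linf_norm (linf_mul a b) <= linf_norm a * linf_norm b.
Proof.
apply: linf_norm_le => n; rewrite (le_trans (rnormM _ _)) //.
by rewrite ler_pM ?rnorm_ge0 ?linf_norm_ub.
Qed.

Lemma linf_norm1 : linf_norm linf_one = 1.
Proof.
apply/le_anti/andP; split.
  by apply: linf_norm_le => n; rewrite rnorm1.
by rewrite -(rnorm1 (A 0)) (linf_norm_ub linf_one 0).
Qed.

Lemma linf_normZ k a : linf_norm (k *: a) = complex.Re `|k| * linf_norm a.
Proof.
have k0 : 0 <= complex.Re `|k| := rnorm_ge0 (k : R[i]^o).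
apply/le_anti/andP; split.
  by apply: linf_norm_le => n; rewrite linfZE rnormZ ler_wpM2l ?linf_norm_ub.
have := k0; rewrite [0 <= _]le_eqVlt => /orP[/eqP <-|{}k0].
  by rewrite mul0r linf_norm_ge0.
rewrite -ler_pdivlMl //; apply: linf_norm_le => n.
by rewrite ler_pdivlMl // -rnormZ (linf_norm_ub (k *: a)).
Qed.

Let linf_cnorm a : R[i] := (linf_norm a)%:C.

Let linf_cnormD a b : linf_cnorm (a + b) <= linf_cnorm a + linf_cnorm b.
Proof.
rewrite -rmorphD lecR; apply: linf_norm_le => n.
by rewrite (le_trans (rnormD _ _)) ?lerD ?linf_norm_ub.
Qed.

Let linf_cnormZ k a : linf_cnorm (k *: a) = `|k| * linf_cnorm a.
Proof.
by rewrite /linf_cnorm linf_normZ -[`|k| in RHS](ReK (normr_ge0 k)) rmorphM.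
Qed.

Let linf_cnorm0_eq0 a : linf_cnorm a = 0 -> a = 0.
Proof.
move=> /(@complexI R) a0; apply: linfP => n; apply: rnorm0_eq0.
by apply/le_anti; rewrite rnorm_ge0 -a0 linf_norm_ub.
Qed.

HB.instance Definition _ := Lmodule_isNormed.Build R[i] linf
  linf_cnormD linf_cnormZ linf_cnorm0_eq0.

Lemma rnorm_linf a : rnorm a = linf_norm a. Proof. by []. Qed.

Lemma linf_fast_complete : fast_complete linf.
Proof.
move=> u fu.
have L (n : nat) : {l : A n | forall j : nat,
    rnorm (l - u j n) <= 2 * 2^-1 ^+ j}.
  apply: cid; apply: (@complete_fast _ _ (fun j => u j n)) => j.
  rewrite -linfBE.
  exact: le_lt_trans (linf_norm_ub _ _) (fu j).
pose l n := sval (L n).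
have ul n : forall j, rnorm (l n - u j n) <= 2 * 2^-1 ^+ j := svalP (L n).
have lb : exists M : R, forall n, rnorm (l n) <= M.
  exists (2 + linf_norm (u 0%N)) => n.
  rewrite -(subrK (u 0%N n) (l n)) (le_trans (rnormD _ _)) // lerD //.
    by rewrite (le_trans (ul n 0%N)) // expr0 mulr1.
  exact: linf_norm_ub.
by exists (Linf lb) => k; apply: linf_norm_le => n; exact: ul.
Qed.

HB.instance Definition _ :=
  Uniform_isComplete.Build linf (fast_cauchy_cvg linf_fast_complete).

Let linf_mulA : associative linf_mul.
Proof. by move=> a b c; apply: linfP => n /=; rewrite mulrA. Qed.
Let linf_mul1x : left_id linf_one linf_mul.
Proof. by move=> a; apply: linfP => n /=; rewrite mul1r. Qed.
Let linf_mulx1 : right_id linf_one linf_mul.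
Proof. by move=> a; apply: linfP => n /=; rewrite mulr1. Qed.
Let linf_mulDl : left_distributive linf_mul +%R.
Proof. by move=> a b c; apply: linfP => n /=; rewrite mulrDl. Qed.
Let linf_mulDr : right_distributive linf_mul +%R.
Proof. by move=> a b c; apply: linfP => n /=; rewrite mulrDr. Qed.
Let linf_scaleAl k a b : k *: linf_mul a b = linf_mul (k *: a) b.
Proof. by apply: linfP => n /=; rewrite scalerAl. Qed.
Let linf_scaleAr k a b : k *: linf_mul a b = linf_mul a (k *: b).
Proof. by apply: linfP => n /=; rewrite scalerAr. Qed.
Let linf_cnormM a b : `|linf_mul a b| <= `|a| * `|b|.
Proof. by rewrite !rnormE -rmorphM lecR linf_normM. Qed.
Let linf_cnorm1 : `|linf_one| = 1.
Proof. by rewrite rnormE rnorm_linf linf_norm1. Qed.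

Definition ell_infty : banachAlgType R := @BanachAlg R linf linf_one linf_mul
  linf_mulA linf_mul1x linf_mulx1 linf_mulDl linf_mulDr
  linf_scaleAl linf_scaleAr linf_cnormM linf_cnorm1.

End BoundedSequences.

Section AsymptoticSequenceAlgebra.
Variables (R : realType) (A : nat -> banachAlgType R).
Implicit Types (a b : linf A) (k : R[i]).

Definition c0 : {pred linf A} :=
  fun a => `[< rnorm (a n) @[n --> \oo] --> (0 : R) >].

Lemma c0P a : reflect
  (forall e : R, 0 < e -> \forall n \near \oo, rnorm (a n) < e) (a \in c0).
Proof.
apply: (iffP (asboolP _)) => [/cvgrPdist_lt ae e e0|ae].
  apply: filterS (ae e e0) => n.
  by rewrite sub0r normrN ger0_norm ?rnorm_ge0.
apply/cvgrPdist_lt => e e0; apply: filterS (ae e e0) => n.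
by rewrite sub0r normrN ger0_norm ?rnorm_ge0.
Qed.

Let c0_scaled a b (M : R) : 0 <= M -> a \in c0 ->
  (forall n, rnorm (b n) <= M * rnorm (a n)) -> b \in c0.
Proof.
move=> M0 /c0P ac bM; apply/c0P => e e0.
have M1 : 0 < M + 1 by rewrite ltr_wpDl.
apply: filterS (ac (e / (M + 1)) _) => [n|]; last by rewrite divr_gt0.
rewrite ltr_pdivlMr // mulrC => ane; apply: le_lt_trans ane.
by rewrite (le_trans (bM n)) // ler_wpM2r ?rnorm_ge0 // lerDl.
Qed.

Lemma c0_zmod_closed : zmod_closed c0.
Proof.
split; first by apply/c0P => e e0; exists 0%N => // n _; rewrite rnorm0.
move=> a b /c0P ac /c0P bc; apply/c0P => e e0.
have e2 : 0 < e / 2 by rewrite divr_gt0.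
apply: filterS2 (ac _ e2) (bc _ e2) => n an bn.
by rewrite (splitr e) (le_lt_trans (rnormD _ _)) // rnormN ltrD.
Qed.

HB.instance Definition _ := GRing.isZmodClosed.Build (linf A) c0 c0_zmod_closed.

Lemma c0Z k a : a \in c0 -> k *: a \in c0.
Proof.
move=> ac; apply: (c0_scaled (rnorm_ge0 (k : R[i]^o)) ac) => n.
by rewrite linfZE rnormZ.
Qed.

Lemma c0Ml a b : b \in c0 -> linf_mul a b \in c0.
Proof.
move=> bc; apply: (c0_scaled (linf_norm_ge0 a) bc) => n.
by rewrite (le_trans (rnormM _ _)) // ler_wpM2r ?rnorm_ge0 ?linf_norm_ub.
Qed.

Lemma c0Mr a b : a \in c0 -> linf_mul a b \in c0.
Proof.
move=> ac; apply: (c0_scaled (linf_norm_ge0 b) ac) => n.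
rewrite (le_trans (rnormM _ _)) // mulrC.
by rewrite ler_wpM2r ?rnorm_ge0 ?linf_norm_ub.
Qed.

Lemma c0_closed : closed [set` c0].
Proof.
move=> a ca; apply/c0P => e e0.
have [|b []] := ca (ball a (e / 2)%:C).
  by apply: nbhsx_ballx; rewrite ltcR divr_gt0.
move=> /= /c0P bc; rewrite -ball_normE /= rnormE ltcR rnorm_linf => ab.
apply: filterS (bc (e / 2) _) => [n bn|]; last by rewrite divr_gt0.
rewrite -(subrK (b n) (a n)) (le_lt_trans (rnormD _ _)) // (splitr e) ltrD //.
by rewrite (le_lt_trans _ ab) // (linf_norm_ub (a - b)).
Qed.

Definition asy : Type := Quotient.quot c0.

HB.instance Definition _ := Choice.on asy.
HB.instance Definition _ := EqQuotient.on asy.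
HB.instance Definition _ := GRing.Zmodule.on asy.

Implicit Types x y : asy.

Lemma asy_eq a b : (\pi_asy a = \pi_asy b) <-> (a - b \in c0).
Proof. by rewrite Quotient.idealrBE; split => [->//|/eqP]. Qed.

Lemma asy_piD a b : \pi_asy (a + b) = \pi_asy a + \pi_asy b.
Proof. by rewrite [LHS]Quotient.pi_add. Qed.

Lemma asy_piB a b : \pi_asy (a - b) = \pi_asy a - \pi_asy b.
Proof. by rewrite asy_piD; congr (_ + _); rewrite [LHS]Quotient.pi_opp. Qed.

Definition asy_one : asy := \pi_asy (linf_one A).
Definition asy_mul x y : asy := \pi_asy (linf_mul (repr x) (repr y)).
Definition asy_scale k x : asy := \pi_asy (k *: repr x).

Let repr_c0 a : a - repr (\pi_asy a) \in c0.
Proof. by apply/asy_eq; rewrite reprK. Qed.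

Lemma asy_piM a b : \pi_asy (linf_mul a b) = asy_mul (\pi_asy a) (\pi_asy b).
Proof.
apply/asy_eq; set a' := repr _; set b' := repr _.
have -> : linf_mul a b - linf_mul a' b' =
    linf_mul (a - a') b + linf_mul a' (b - b').
  apply: linfP => n; rewrite [LHS]linfBE [RHS]linfDE.
  by rewrite !linfME [(a - a') n]linfBE [(b - b') n]linfBE mulrBl mulrBr subrKA.
by apply: rpredD; [apply: c0Mr|apply: c0Ml]; exact: repr_c0.
Qed.

Lemma asy_piZ k a : \pi_asy (k *: a) = asy_scale k (\pi_asy a).
Proof. by apply/asy_eq; rewrite -scalerBr c0Z ?repr_c0. Qed.

Lemma asyP (P : asy -> Prop) : (forall a, P (\pi_asy a)) -> forall x, P x.
Proof. by move=> Pa x; rewrite -(reprK x). Qed.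

Let asy_scaleA k l x : asy_scale k (asy_scale l x) = asy_scale (k * l) x.
Proof. by elim/asyP: x => a; rewrite -!asy_piZ scalerA. Qed.
Let asy_scale1 : left_id 1 asy_scale.
Proof. by elim/asyP => a; rewrite -asy_piZ scale1r. Qed.
Let asy_scaleDr : right_distributive asy_scale +%R.
Proof.
move=> k; elim/asyP => a; elim/asyP => b.
by rewrite -!(asy_piZ, asy_piD) scalerDr.
Qed.
Let asy_scaleDl x : {morph asy_scale^~ x : k l / k + l}.
Proof.
by elim/asyP: x => a k l /=; rewrite -!asy_piZ scalerDl asy_piD.
Qed.

HB.instance Definition _ := GRing.Zmodule_isLmodule.Build R[i] asy
  asy_scaleA asy_scale1 asy_scaleDr asy_scaleDl.

Lemma asy_scaleE k a : \pi_asy (k *: a) = k *: \pi_asy a.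
Proof. exact: asy_piZ. Qed.

Definition asy_norm x : R :=
  inf [set linf_norm a | a in [set a | \pi_asy a = x]].

Let asy_norm_has_lbound x :
  has_lbound [set linf_norm a | a in [set a | \pi_asy a = x]].
Proof. by exists 0 => _ [a _ <-]; exact: linf_norm_ge0. Qed.

Lemma asy_norm_le a : asy_norm (\pi_asy a) <= linf_norm a.
Proof. by apply: ge_inf => //; exists a. Qed.

Lemma asy_norm_ge x (m : R) :
  (forall a, \pi_asy a = x -> m <= linf_norm a) -> m <= asy_norm x.
Proof.
move=> mx; apply: lb_le_inf => [|_ [a /= ax <-]]; last exact: mx.
by exists (linf_norm (repr x)), (repr x) => //=; rewrite reprK.
Qed.

Lemma asy_norm_ge0 x : 0 <= asy_norm x.
Proof. by apply: asy_norm_ge => a _; exact: linf_norm_ge0. Qed.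

Lemma asy_norm_lt x (m : R) :
  asy_norm x < m -> exists2 a, \pi_asy a = x & linf_norm a < m.
Proof.
move=> xm; apply: contrapT => nx; move: xm; apply/negP; rewrite -leNgt.
apply: asy_norm_ge => a ax; rewrite leNgt; apply/negP => am.
by apply: nx; exists a.
Qed.

Let asy_norm_scale x (m c : R) : 0 <= c ->
  (forall a, \pi_asy a = x -> m <= c * linf_norm a) -> m <= c * asy_norm x.
Proof.
rewrite le_eqVlt => /orP[/eqP <- mx|c0 mx].
  by rewrite mul0r (le_trans (mx (repr x) _)) ?mul0r // reprK.
by rewrite -ler_pdivrMl //; apply: asy_norm_ge => a ax; rewrite ler_pdivrMl ?mx.
Qed.

Lemma asy_normD x y : asy_norm (x + y) <= asy_norm x + asy_norm y.
Proof.
rewrite -lerBlDr; apply: asy_norm_ge => a <-.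
rewrite lerBlDl -lerBlDr; apply: asy_norm_ge => b <-.
rewrite lerBlDr -asy_piD (le_trans (asy_norm_le _)) // addrC.
by rewrite -(@lecR R) rmorphD /= -!rnorm_linf -!rnormE ler_normD.
Qed.

Lemma asy_normZ k x : asy_norm (k *: x) = complex.Re `|k| * asy_norm x.
Proof.
have le_normZ l y : asy_norm (l *: y) <= complex.Re `|l| * asy_norm y.
  apply: asy_norm_scale => [|a <-]; first exact: (rnorm_ge0 (l : R[i]^o)).
  by rewrite -asy_scaleE -linf_normZ asy_norm_le.
apply/le_anti/andP; split; [exact: le_normZ|have [->|k0] := eqVneq k 0].
  by rewrite normr0 mul0r asy_norm_ge0.
have nk0 : 0 < complex.Re `|k| by apply: (Re_gt0 _).1; rewrite normr_gt0.
rewrite -ler_pdivlMl //; have := le_normZ k^-1 (k *: x).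
by rewrite scalerK // normfV -(ReK (normr_ge0 k)) -fmorphV.
Qed.

Lemma asy_norm0_eq0 x : asy_norm x = 0 -> x = 0.
Proof.
move=> x0; rewrite -(reprK x) -(reprK 0); apply/asy_eq.
set a := repr x - _; have xa : \pi_asy a = x by rewrite asy_piB !reprK subr0.
apply: c0_closed => B /nbhs_ballP[e /= /Re_gt0[]].
move: (complex.Re e) => r r0 -> aB; have [|b bx br] := @asy_norm_lt x r.
  by rewrite x0.
exists (a - b); split; first by apply/asy_eq; rewrite xa bx.
by apply: aB; rewrite -ball_normE /= opprB addrC subrK rnormE ltcR.
Qed.

Let asy_cnorm x : R[i] := (asy_norm x)%:C.

Let asy_cnormD x y : asy_cnorm (x + y) <= asy_cnorm x + asy_cnorm y.
Proof. by rewrite -rmorphD lecR asy_normD. Qed.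

Let asy_cnormZ k x : asy_cnorm (k *: x) = `|k| * asy_cnorm x.
Proof.
by rewrite /asy_cnorm asy_normZ -[`|k| in RHS](ReK (normr_ge0 k)) rmorphM.
Qed.

Let asy_cnorm0_eq0 x : asy_cnorm x = 0 -> x = 0.
Proof. by move=> /(@complexI R) /asy_norm0_eq0. Qed.

HB.instance Definition _ := Lmodule_isNormed.Build R[i] asy
  asy_cnormD asy_cnormZ asy_cnorm0_eq0.

Lemma rnorm_asy x : rnorm x = asy_norm x. Proof. by []. Qed.

Lemma asy_fast_complete : fast_complete asy.
Proof.
move=> u fu.
have D (j : nat) : {d : linf A | \pi_asy d = u j.+1 - u j &
    linf_norm d < 2^-1 ^+ j} by apply: cid2; exact: asy_norm_lt.
pose d j := s2val (D j).
pose s j := repr (u 0%N) + \sum_(i < j) d i.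
have sS (j : nat) : s j.+1 = s j + d j by rewrite /s big_ord_recr addrA.
have sE (j : nat) : \pi_asy (s j) = u j.
  elim: j => [|j IH]; first by rewrite /s big_ord0 addr0 reprK.
  by rewrite sS asy_piD IH (s2valP (D j)) addrC subrK.
have [|l ls] := @linf_fast_complete R A s.
  by move=> j; rewrite sS addrAC subrr add0r; exact: (s2valP' (D j)).
exists (\pi_asy l) => j; rewrite -sE -asy_piB.
exact: le_trans (asy_norm_le _) (ls j).
Qed.

HB.instance Definition _ :=
  Uniform_isComplete.Build asy (fast_cauchy_cvg asy_fast_complete).

Let asy_mulA : associative asy_mul.
Proof.
elim/asyP=> a; elim/asyP=> b; elim/asyP=> c; rewrite -!asy_piM.
by congr (\pi_asy _); apply: linfP => n; rewrite !linfME mulrA.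
Qed.
Let asy_mul1x : left_id asy_one asy_mul.
Proof.
elim/asyP=> a; rewrite -!asy_piM.
by congr (\pi_asy _); apply: linfP => n; rewrite !linfME mul1r.
Qed.
Let asy_mulx1 : right_id asy_one asy_mul.
Proof.
elim/asyP=> a; rewrite -!asy_piM.
by congr (\pi_asy _); apply: linfP => n; rewrite !linfME mulr1.
Qed.
Let asy_mulDl : left_distributive asy_mul +%R.
Proof.
elim/asyP=> a; elim/asyP=> b; elim/asyP=> c; rewrite -!(asy_piM, asy_piD).
by congr (\pi_asy _); apply: linfP => n; rewrite !(linfME, linfDE) mulrDl.
Qed.
Let asy_mulDr : right_distributive asy_mul +%R.
Proof.
elim/asyP=> a; elim/asyP=> b; elim/asyP=> c; rewrite -!(asy_piM, asy_piD).
by congr (\pi_asy _); apply: linfP => n; rewrite !(linfME, linfDE) mulrDr.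
Qed.
Let asy_scaleAl k x y : k *: asy_mul x y = asy_mul (k *: x) y.
Proof.
elim/asyP: x => a; elim/asyP: y => b; rewrite -!(asy_piM, asy_scaleE).
by congr (\pi_asy _); apply: linfP => n; rewrite !(linfME, linfZE) scalerAl.
Qed.
Let asy_scaleAr k x y : k *: asy_mul x y = asy_mul x (k *: y).
Proof.
elim/asyP: x => a; elim/asyP: y => b; rewrite -!(asy_piM, asy_scaleE).
by congr (\pi_asy _); apply: linfP => n; rewrite !(linfME, linfZE) scalerAr.
Qed.
Let asy_cnormM x y : `|asy_mul x y| <= `|x| * `|y|.
Proof.
rewrite !rnormE -rmorphM lecR !rnorm_asy.
apply: asy_norm_scale => [|b <-]; first exact: asy_norm_ge0.
rewrite mulrC; apply: asy_norm_scale => [|a <-]; first exact: linf_norm_ge0.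
by rewrite -asy_piM mulrC (le_trans (asy_norm_le _)) ?linf_normM.
Qed.
Let asy_cnorm1 : `|asy_one| = 1.
Proof.
rewrite rnormE rnorm_asy; congr _%:C; apply/le_anti/andP; split.
  by rewrite (le_trans (asy_norm_le _)) ?linf_norm1.
apply: asy_norm_ge => a /asy_eq/c0P ac; apply/ler_addgt0Pr => e e0.
have [N _ /(_ N (leqnn N))] := ac e e0.
rewrite linfBE -(rnorm1 (A N)) => aN.
rewrite -[X in rnorm X <= _](subrK (a N)) (le_trans (rnormD _ _)) //.
by rewrite addrC lerD ?linf_norm_ub // ltW // rnormB.
Qed.

Definition Asy : banachAlgType R := @BanachAlg R asy asy_one asy_mul
  asy_mulA asy_mul1x asy_mulx1 asy_mulDl asy_mulDr
  asy_scaleAl asy_scaleAr asy_cnormM asy_cnorm1.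

End AsymptoticSequenceAlgebra.

(* Main.v *)
Require Import Defs.
From mathcomp Require Import all_boot all_order all_algebra.
From mathcomp Require Import complex.
From mathcomp Require Import all_classical all_reals all_analysis.
From mathcomp Require Import lra.

Set Implicit Arguments.
Unset Strict Implicit.
Unset Printing Implicit Defensive.

(** If [ba = 1] in the asymptotic algebra, lift [a] and [b] to bounded sequences
    with [b_n a_n -> 1].  Eventually [b_n a_n] has a left inverse [c_n] of norm
    at most 2 (Neumann series), so [(c_n b_n) a_n = 1] and Dedekind-finiteness
    of [A_n] gives [a_n c_n b_n = 1].  Hence
    [1 - a_n b_n = a_n (c_n - 1) b_n = a_n c_n (1 - b_n a_n) b_n -> 0]. *)

Import Order.TTheory GRing.Theory Num.Theory.

Local Open Scope ring_scope.

(** If [b * a = 1], then [a * b] is idempotent, since [a * (b * a) * b = a * b], and it is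
    equivalent to [1]. *)
Lemma dedekind_finiteP (A : pzRingType) :
  dedekind_finite A <-> forall a b : A, b * a = 1 -> a * b = 1.
Proof.
split=> [hA a b ba1|hA p _ [a [b [-> /esym]]]]; last exact: hA.
by apply: hA; [rewrite /idempotent_elt mulrA -(mulrA a) ba1 mulr1|exists a, b].
Qed.

Section Neumann.
Variables (R : realType) (A : banachAlgType R).

Lemma rnormX (y : A) k : rnorm (y ^+ k) <= rnorm y ^+ k.
Proof.
elim: k => [|k IH]; first by rewrite !expr0 rnorm1.
by rewrite !exprS (le_trans (rnormM _ _)) // ler_wpM2l ?rnorm_ge0.
Qed.

Lemma left_inverse_near1 (x : A) : rnorm (1 - x) <= 2^-1 ->
  exists2 c : A, c * x = 1 & rnorm c <= 2.
Proof.
set y := 1 - x => y2; have xE : x = 1 - y by rewrite /y subKr.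
have yX (k : nat) : rnorm (y ^+ k) <= 2^-1 ^+ k.
  by rewrite (le_trans (rnormX _ _)) // lerXn2r ?nnegrE ?rnorm_ge0 ?invr_ge0.
(* Starting with one term makes step [k] equal to [y ^+ k.+1], of norm at most [2^-1 ^+ k.+1]; this
   gives the strict bound that [fast] demands. *)
pose u k := \sum_(i < k.+1) y ^+ i.
have uS (k : nat) : u k.+1 = u k + y ^+ k.+1 by rewrite /u big_ord_recr.
have [c cu] : exists c : A, forall k, rnorm (c - u k) <= 2 * 2^-1 ^+ k.
  apply: complete_fast => k.
  rewrite uS addrAC subrr add0r (le_lt_trans (yX _)) //.
  by rewrite exprS gtr_pMl ?exprn_gt0 ?invr_gt0 // invf_lt1 // ltr1n.
have uE (k : nat) : u k * x = 1 - y ^+ k.+1.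
  elim: k => [|k IH]; first by rewrite /u big_ord1 mul1r.
  by rewrite uS mulrDl IH xE mulrBr mulr1 -exprSr subrKA.
have cx1 : c * x = 1.
  apply/eqP; rewrite -subr_eq0; apply/eqP/rnorm0_eq0/le_anti.
  rewrite rnorm_ge0 andbT; apply/ler_addgt0Pr => e e0; rewrite add0r.
  (* With [t = 2^-1 ^+ k], the two error terms are at most [3 * t] and [t / 2], together at most
     [4 * t < e]. *)
  have [|k ke] := @exp2V_lt R (e / 4); first by rewrite divr_gt0.
  have -> : c * x - 1 = (c - u k) * x - y ^+ k.+1.
    by rewrite mulrBl uE opprB addrA addrAC addrK.
  rewrite (le_trans (rnormD _ _)) // rnormN.
  have x2 : rnorm x <= 3 / 2.
    rewrite xE (le_trans (rnormD _ _)) // rnormN rnorm1; lra.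
  have h1 : rnorm ((c - u k) * x) <= (2 * 2^-1 ^+ k) * (3 / 2).
    by rewrite (le_trans (rnormM _ _)) // ler_pM ?rnorm_ge0.
  have := yX k.+1; rewrite [2^-1 ^+ _]exprS.
  have : 0 <= 2^-1 ^+ k :> R by rewrite exprn_ge0 // invr_ge0.
  move: h1 ke; move: (2^-1 ^+ k) => t; lra.
exists c => //.
(* Comparing [c] with [u 0 = 1] would only give the bound 3; this fixed-point equation lets the norm
   of [c] be absorbed and gives 2. *)
have cE : c = 1 + c * y by rewrite /y mulrBr mulr1 cx1 subrKC.
have : rnorm c <= 1 + rnorm c * 2^-1.
  rewrite {1}cE (le_trans (rnormD _ _)) // rnorm1 lerD2l.
  by rewrite (le_trans (rnormM _ _)) // ler_wpM2l ?rnorm_ge0.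
lra.
Qed.

(** The constants do not depend on the algebra, so the estimate holds uniformly along the sequence;
    the factor 2 bounds the norm of the left inverse of [b * a]. *)
Lemma dedekind_finite_near (hA : dedekind_finite A) (a b : A) :
  rnorm (1 - b * a) <= 2^-1 ->
  rnorm (1 - a * b) <= 2 * rnorm a * rnorm b * rnorm (1 - b * a).
Proof.
move=> /[dup] ba /left_inverse_near1[c cba c2].
have acb : a * (c * b) = 1.
  by apply: (dedekind_finiteP A).1 => //; rewrite -mulrA.
have -> : 1 - a * b = a * (c * (1 - b * a)) * b.
  by rewrite mulrBr cba mulr1 mulrBr mulr1 mulrBl -[a * c * b]mulrA acb.
apply: (le_trans (rnormM _ _)); rewrite mulrAC ler_wpM2r ?rnorm_ge0 //.
rewrite (le_trans (rnormM _ _)) // [2 * _]mulrC -mulrA ler_wpM2l ?rnorm_ge0 //.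
by rewrite (le_trans (rnormM _ _)) // ler_wpM2r ?rnorm_ge0.
Qed.

End Neumann.

Theorem theorem3p1 (R : realType) (A : nat -> banachAlgType R)
    (hA : forall n : nat, dedekind_finite (A n)) :
  dedekind_finite (Asy A).
Proof.
apply/dedekind_finiteP; elim/asyP => a; elim/asyP => b.
change (asy_mul (\pi_(asy A) b)%qT (\pi_(asy A) a)%qT = asy_one A ->
        asy_mul (\pi_(asy A) a)%qT (\pi_(asy A) b)%qT = asy_one A).
rewrite -!asy_piM => /esym/asy_eq/c0P ba; apply/esym/asy_eq/c0P => e e0.
have [M aM] := linf_bounded a; have [N bN] := linf_bounded b.
have M0 : 0 <= M := le_trans (rnorm_ge0 _) (aM 0%N).
have N0 : 0 <= N := le_trans (rnorm_ge0 _) (bN 0%N).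
(* The [+ 1] keeps the divisor positive even when [M] or [N] is 0. *)
have K0 : 0 < 2 * M * N + 1 by rewrite ltr_wpDl // !mulr_ge0.
(* The first threshold makes [dedekind_finite_near] applicable, the second brings its bound below
   [e]. *)
apply: filterS2 (ba 2^-1 _) (ba (e / (2 * M * N + 1)) _) => [n||].
- rewrite !linfBE !linfME /= => /ltW/(dedekind_finite_near (hA n)) h.
  rewrite ltr_pdivlMr // mulrC => le_e; apply: le_lt_trans le_e.
  apply: le_trans h _; rewrite ler_wpM2r ?rnorm_ge0 // ler_wpDr //.
  by rewrite ler_pM ?mulr_ge0 ?rnorm_ge0 // ler_wpM2l.
- by rewrite invr_gt0.
- by rewrite divr_gt0.
Qed.
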